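(* Let $\mathcal{X}$ be a finite set with $|\mathcal{X}|\ge 2$, let $\mu$ be a non-degenerate probability measure on $\mathcal{X}$, let $P$ be a Markov transition matrix on $\mathcal{X}$ for which $\mu$ is reversible, and let $f:\mathcal{X}\to\mathbb{R}$. Define the asymmetric Lipschitz constant $$\widetilde{\Phi}^{\mathrm{Lip}}_{\mathrm{asym}}(P;f)=\max_{x\in\mathcal{X}}\Big(\sum_{y\in\mathcal{X}}P(x,y)\,|f(x)-f(y)|^2\,\mathbf{1}_{(0,\infty)}\big(f(x)-f(y)\big)\Big)^{1/2}$$ and $$\widetilde{\Xi}^+_P(\mu,f)=\frac{2\big(\Lambda^{(1)}_\mu(P)\big)^{1/2}}{\widetilde{\Phi}^{\mathrm{Lip}}_{\mathrm{asym}}(P;f)},$$ and assume $\Lambda^{(1)}_\mu(P)>0$ and $\widetilde{\Phi}^{\mathrm{Lip}}_{\mathrm{asym}}(P;f)>0$. Then for every $\lambda\ge 0$ with $\lambda<\widetilde{\Xi}^+_P(\mu,f)$, $$\ln\Big(\mathbb{E}_\mu\big[e^{\lambda f}\big]\Big)\le \lambda\,\mathbb{E}_\mu[f]+\Theta\!\left(\frac{\lambda}{\widetilde{\Xi}^+_P(\mu,f)}\right).$$ Consequently, for every $a\ge 0$, $$-\ln\big(\mathcal{F}^+_\mu(f;a)\big)\ge \max_{0\le\lambda<\widetilde{\Xi}^+_P(\mu,f)}\left(\lambda a-\Theta\!\left(\frac{\lambda}{\widetilde{\Xi}^+_P(\mu,f)}\right)\right).$$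
   Context: Non-degenerate means $\mu(x)>0$ for all $x\in\mathcal{X}$. Reversible means $\mu(x)P(x,y)=\mu(y)P(y,x)$ for all $x,y\in\mathcal{X}$. $\mathbb{E}_\mu$ and $\operatorname{Var}_\mu$ denote expectation and variance under $\mu$. The Dirichlet form is $\mathcal{E}_{P,\mu}(f,g)=\frac12\sum_{x,y\in\mathcal{X}}(f(x)-f(y))(g(x)-g(y))\,\mu(x)P(x,y)$. The spectral gap is $\Lambda^{(1)}_\mu(P)=\min\{\mathcal{E}_{P,\mu}(g,g): g:\mathcal{X}\to\mathbb{R},\ \operatorname{Var}_\mu(g)\ge 1\}$ (it is strictly positive if $P$ is irreducible). The positive fluctuation function is $\mathcal{F}^+_\mu(f;a)=\mu(\{x\in\mathcal{X}: f(x)-\mathbb{E}_\mu[f]\ge a\})$ for $a\in[0,\infty)$, with the convention $-\ln 0=+\infty$. The function $\Theta:[0,1)\to[0,\infty)$ is $\Theta(t)=\sum_{n=0}^\infty 2^n\ln\left(\frac{1}{1-t\cdot 2^{-2n}}\right)$. *)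

(* Defs.v *)
From mathcomp Require Import all_boot all_order all_algebra.
From mathcomp Require Import all_classical all_reals all_analysis.

Set Implicit Arguments.
Unset Strict Implicit.
Unset Printing Implicit Defensive.

Import Order.TTheory GRing.Theory Num.Theory.
Import numFieldNormedType.Exports.

Local Open Scope classical_set_scope.
Local Open Scope ring_scope.

Section FiniteMarkov.
Context {R : realType} {X : finType}.

Definition is_probability (mu : X -> R) : Prop :=
  (forall x, 0 <= mu x) /\ \sum_x mu x = 1.

Definition non_degenerate (mu : X -> R) : Prop := forall x, 0 < mu x.

Definition is_transition_matrix (P : X -> X -> R) : Prop :=
  (forall x y, 0 <= P x y) /\ (forall x, \sum_y P x y = 1).

Definition reversible (mu : X -> R) (P : X -> X -> R) : Prop :=
  forall x y, mu x * P x y = mu y * P y x.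

Definition Ex (mu : X -> R) (g : X -> R) : R := \sum_x mu x * g x.

Definition Var (mu : X -> R) (g : X -> R) : R :=
  Ex mu (fun x => (g x - Ex mu g) ^+ 2).

Definition dirichlet_form (P : X -> X -> R) (mu f g : X -> R) : R :=
  2^-1 * \sum_x \sum_y (f x - f y) * (g x - g y) * (mu x * P x y).

(* For [mu] a non-degenerate probability and [#|X| >= 2], the infimum is a
   minimum: modulo constants, and after rescaling to variance 1, the form is
   a continuous function on a compact set.  [inf] of an empty set is 0, but
   the set below is nonempty in that case. *)
Definition spectral_gap (mu : X -> R) (P : X -> X -> R) : R :=
  inf [set dirichlet_form P mu g g | g in [set g | 1 <= Var mu g]].

(* The default value 0 of the iterated maximum is harmless, all the square
   roots being nonnegative. *)
Definition asym_lipschitz (P : X -> X -> R) (f : X -> R) : R :=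
  \big[Num.max/0]_(x : X)
    Num.sqrt (\sum_y P x y * `|f x - f y| ^+ 2
                     * \1_(`]0, +oo[ : set R) (f x - f y)).

Definition Xi_plus (P : X -> X -> R) (mu f : X -> R) : R :=
  2 * Num.sqrt (spectral_gap mu P) / asym_lipschitz P f.

Definition fluctuation_plus (mu f : X -> R) (a : R) : R :=
  \sum_(x | a <= f x - Ex mu f) mu x.

End FiniteMarkov.

(* Meaningful on [0, 1), where the series converges. *)
Definition Theta {R : realType} (t : R) : R :=
  limn (series (fun n : nat => 2 ^+ n * ln (1 / (1 - t * 2 ^- (2 * n))))).

Definition is_maximum {R : realType} (A : set R) (m : R) : Prop :=
  A m /\ ubound A m.

(* Main.v *)
(** Testing the Poincare inequality on [exp (lambda f / 2)] gives, for the
    moment generating function [M] of [f] and [t = lambda / Xi],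
    [(1 - t^2) M(lambda) <= M(lambda/2)^2]: the variance of the test function
    is [M(lambda) - M(lambda/2)^2], and by reversibility its Dirichlet form only
    involves the pairs with [f x > f y].  Iterating [lambda |-> lambda/2] sums the
    logarithms of these factors into [Theta t] (as [t^2 <= t]), while the remainder
    [2^n ln M(lambda/2^n)] tends to [lambda E f].  The tail bound is Chernoff's;
    the maximum is attained because [Theta] is continuous on [0, 1) and tends to
    [+oo] at [1]. *)

Require Import Defs.
From mathcomp Require Import all_boot all_order all_algebra.
From mathcomp Require Import all_classical all_reals all_analysis.
From mathcomp Require Import ring lra.

Import Order.TTheory GRing.Theory Num.Theory.
Import numFieldNormedType.Exports.

Local Open Scope classical_set_scope.
Local Open Scope ring_scope.

(** * The series [Theta]: convergence, local Lipschitz bound, behaviour at 1 *)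

Definition Theta_term {R : realType} (t : R) (n : nat) : R :=
  2 ^+ n * ln (1 / (1 - t * 2 ^- (2 * n))).

(** The difference is [2 ^+ n * ln (1 + x)] with [x = (t - s) 4^-n / (1 - t 4^-n)], and
    [0 <= ln (1 + x) <= x]; the weight [2 ^+ n] leaves a factor [2 ^- n]. Taking [s = 0] gives
    convergence, and a fixed [c] gives continuity. *)
Lemma Theta_termB {R : realType} (c s t : R) (n : nat) :
  0 <= s -> s <= t -> t <= c -> c < 1 ->
  0 <= Theta_term t n - Theta_term s n <= (t - s) / (1 - c) * 2 ^- n.
Proof.
move=> s0 st tc c1; rewrite /Theta_term -mulrBr.
have p0 : (0 : R) < 2 ^+ n by rewrite exprn_gt0.
have p1 : (1 : R) <= 2 ^+ n by rewrite exprn_ege1// ler1n.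
have -> : (2 : R) ^- (2 * n) = 2 ^- n * 2 ^- n.
  by rewrite mulnC exprM expr2 invfM.
set p : R := 2 ^+ n in p0 p1 *; set u := p^-1.
have u0 : 0 < u by rewrite invr_gt0.
have u1 : u <= 1 by rewrite invf_le1.
have uu1 : u * u <= 1 by nra.
have uu0 : 0 < u * u by nra.
have pt : 0 < 1 - t * (u * u) by nra.
have ps : 0 < 1 - s * (u * u) by nra.
have c0 : 0 < 1 - c by lra.
have tcu : 1 - c <= 1 - t * (u * u) by nra.
rewrite !div1r !lnV ?posrE// opprK addrC -ln_div ?posrE//.
have -> : (1 - s * (u * u)) / (1 - t * (u * u))
          = 1 + (t - s) * (u * u) / (1 - t * (u * u)).
  by field; rewrite gt_eqF.
have x0 : 0 <= (t - s) * (u * u) / (1 - t * (u * u)).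
  by rewrite divr_ge0 ?(ltW pt)// mulr_ge0 ?subr_ge0// ltW.
apply/andP; split; first by apply: mulr_ge0; [exact: ltW | apply: ln_ge0; rewrite lerDl].
apply: (@le_trans _ _ (p * ((t - s) * (u * u) / (1 - t * (u * u))))).
  by rewrite ler_pM2l// le_ln1Dx//; lra.
have -> : (t - s) / (1 - c) * u = p * ((t - s) * (u * u) / (1 - c)).
  by rewrite /u; field; rewrite !gt_eqF.
by rewrite ler_pM2l// ler_wpM2l ?lef_pV2 ?posrE// mulr_ge0 ?subr_ge0// ltW.
Qed.

Lemma Theta_term0 {R : realType} (n : nat) : Theta_term (0 : R) n = 0.
Proof. by rewrite /Theta_term mul0r subr0 divr1 ln1 mulr0. Qed.

Lemma series_Theta_termB {R : realType} (c s t : R) (n : nat) :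
  0 <= s -> s <= t -> t <= c -> c < 1 ->
  0 <= series (Theta_term t) n - series (Theta_term s) n
    <= 2 * ((t - s) / (1 - c)).
Proof.
move=> s0 st tc c1; set K := (t - s) / (1 - c).
have K0 : 0 <= K by rewrite divr_ge0// subr_ge0// ltW.
(* The induction carries the exact geometric partial sum [2 K (1 - 2^-n)]. *)
suff /andP[-> /= h] : 0 <= series (Theta_term t) n - series (Theta_term s) n
    <= 2 * K - 2 * K * 2 ^- n.
  apply: (le_trans h); rewrite gerBl.
  by apply: mulr_ge0; [exact: mulr_ge0 | rewrite invr_ge0 exprn_ge0].
elim: n => [|n].
  by rewrite !seriesEnat /= !big_geq//; apply/andP; split; lra.
rewrite !seriesSr; have := @Theta_termB R c s t n s0 st tc c1.
rewrite -/K exprS invfM; set v := 2 ^- n.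
by move=> /andP[? ?] /andP[? ?]; apply/andP; split; lra.
Qed.

Lemma Theta_term_ge0 {R : realType} (t : R) (n : nat) :
  0 <= t < 1 -> 0 <= Theta_term t n.
Proof.
move=> /andP[t0 t1].
have /andP[] := @Theta_termB R t 0 t n (lexx _) t0 (lexx _) t1.
by rewrite Theta_term0 subr0.
Qed.

Lemma nondecreasing_series_Theta {R : realType} (t : R) :
  0 <= t < 1 -> nondecreasing_seq (series (Theta_term t)).
Proof.
move=> t01; apply/nondecreasing_seqP => n.
by rewrite seriesSr lerDl Theta_term_ge0.
Qed.

Lemma is_cvg_series_Theta {R : realType} (t : R) :
  0 <= t < 1 -> cvgn (series (Theta_term t)).
Proof.
move=> /andP[t0 t1]; apply: nondecreasing_is_cvgn.
  by apply: nondecreasing_series_Theta; rewrite t0.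
exists (2 * ((t - 0) / (1 - t))) => _ [n _ <-].
have /andP[_] := @series_Theta_termB R t 0 t n (lexx _) t0 (lexx _) t1.
suff -> : series (Theta_term (0 : R)) n = 0 by rewrite subr0.
by rewrite seriesEnat /= big1// => i _; rewrite Theta_term0.
Qed.

Lemma series_Theta_le {R : realType} (t : R) (n : nat) :
  0 <= t < 1 -> series (Theta_term t) n <= Theta t.
Proof.
move=> t01; apply: nondecreasing_cvgn_le; first exact: nondecreasing_series_Theta.
exact: is_cvg_series_Theta.
Qed.

Lemma Theta0 {R : realType} : Theta (0 : R) = 0.
Proof.
rewrite /Theta; apply: cvg_lim => //.
under eq_fun do [rewrite -/(Theta_term 0 _)].
rewrite (_ : series _ = fun=> 0); first exact: cvg_cst.
by apply/funext => n; rewrite seriesEnat /= big1// => i _; rewrite Theta_term0.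
Qed.

(** The bound on differences of partial sums is uniform in [n], so it passes to the limit. *)
Lemma Theta_dist_le {R : realType} (c s t : R) :
  0 <= s <= c -> 0 <= t <= c -> c < 1 ->
  `|Theta t - Theta s| <= 2 / (1 - c) * `|t - s|.
Proof.
wlog st : s t / s <= t.
  move=> W hs ht c1; case: (leP s t) => [st|/ltW ts]; first exact: W.
  by rewrite distrC (distrC t); apply: W.
move=> /andP[s0 sc] /andP[t0 tc] c1.
have cs : cvgn (series (Theta_term s)).
  by apply: is_cvg_series_Theta; rewrite s0 (le_lt_trans sc).
have ct : cvgn (series (Theta_term t)).
  by apply: is_cvg_series_Theta; rewrite t0 (le_lt_trans tc).
rewrite (ger0_norm (_ : 0 <= t - s)) ?subr_ge0//.
change (Theta t) with (limn (series (Theta_term t))).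
change (Theta s) with (limn (series (Theta_term s))); rewrite -limB// ger0_norm.
  apply: limr_le; first exact: is_cvgB.
  near=> n; have /andP[_] := @series_Theta_termB R c s t n s0 st tc c1.
  by rewrite mulrCA mulrAC mulrC -mulrA mulrCA; move=> /le_trans; apply; lra.
apply: limr_ge; first exact: is_cvgB.
by near=> n; have /andP[] := @series_Theta_termB R c s t n s0 st tc c1.
Unshelve. all: by end_near. Qed.

Lemma Theta_within_continuous {R : realType} (c : R) :
  c < 1 -> {within `[0, c], continuous (@Theta R)}.
Proof.
move=> c1; apply/subspace_continuousP => x /= xc.
apply/cvgrPdist_le => /= e e0.
have K0 : 0 < 2 / (1 - c) by rewrite divr_gt0// subr_gt0.
rewrite near_withinE; near=> y => /= yc.
rewrite in_itv /= in xc; rewrite in_itv /= in yc.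
have h := @Theta_dist_le R c y x yc xc c1.
apply: (le_trans h).
rewrite -ler_pdivlMl//; near: y.
by apply: cvgr_dist_le; [exact: cvg_id | rewrite mulr_gt0 ?invr_gt0].
Unshelve. all: by end_near. Qed.

(** The left side is the term of index 0 of a series with nonnegative terms. It forces [Theta] to
    blow up at 1. *)
Lemma ln_le_Theta {R : realType} (t : R) : 0 <= t < 1 -> ln (1 / (1 - t)) <= Theta t.
Proof.
move=> t01; have := @series_Theta_le R t 1 t01.
by rewrite seriesEnat /= big_nat1 /Theta_term muln0 expr0 invr1 mulr1 mul1r.
Qed.

(** On [[0, c]] the extreme value theorem applies. For [t > c], [Theta t >= ln (1 / (1 - t)) >= b >=
    t * b], so the objective is at most 0, its value at [t = 0]. *)
Lemma Theta_conjugate_attained {R : realType} (b : R) : 0 <= b ->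
  exists2 t0 : R, 0 <= t0 < 1 &
    forall t : R, 0 <= t < 1 -> t * b - Theta t <= t0 * b - Theta t0.
Proof.
(* This [c] solves [ln (1 / (1 - c)) = b]. *)
move=> b0; set c := 1 - expR (- b).
have eb0 := expR_gt0 (- b).
have eb1 : expR (- b) <= 1 by rewrite -expR0 ler_expR oppr_le0.
have c0 : 0 <= c by rewrite subr_ge0.
have c1 : c < 1 by rewrite /c; lra.
have hc : {within `[0, c], continuous (fun t : R => t * b - Theta t)}.
  apply/subspace_continuousP => x xc; apply: cvgB.
    by apply: cvgMl; exact: cvg_within.
  by have /subspace_continuousP := Theta_within_continuous _ c1; apply.
have [t0 /itvP t0c t0max] := EVT_max c0 hc.
exists t0; first by rewrite t0c (le_lt_trans _ c1)// t0c.
move=> t /andP[tge0 t1]; case: (leP t c) => tc.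
  by apply: t0max; rewrite in_itv /= tge0.
have := t0max 0; rewrite in_itv /= lexx c0 mul0r Theta0 subr0 => /(_ isT).
apply: le_trans; rewrite subr_le0.
apply: (@le_trans _ _ b); first by rewrite ler_piMl// ltW.
have t01 : 0 <= t < 1 by rewrite tge0.
apply: (@le_trans _ _ (ln (1 / (1 - t)))); last exact: ln_le_Theta.
rewrite div1r lnV ?posrE ?subr_gt0// lerNr -(expRK (- b)) ler_ln ?posrE ?subr_gt0//.
by rewrite /c in tc; lra.
Qed.

(** * Variance, Dirichlet form and the Poincare inequality *)

Section Mgf.
Context {R : realType} {X : finType}.
Implicit Types (mu f g : X -> R) (P : X -> X -> R).

Lemma ExZ mu g (c : R) : Ex mu (fun x => c * g x) = c * Ex mu g.
Proof. by rewrite /Ex mulr_sumr; apply: eq_bigr => x _; rewrite mulrCA. Qed.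

Lemma VarZ mu g (c : R) : Var mu (fun x => c * g x) = c ^+ 2 * Var mu g.
Proof.
rewrite /Var ExZ -[RHS]ExZ; apply: eq_bigr => x _.
by rewrite -mulrBr exprMn.
Qed.

Lemma VarE mu g : is_probability mu ->
  Var mu g = Ex mu (fun x => g x ^+ 2) - Ex mu g ^+ 2.
Proof.
move=> [_ mu1]; rewrite /Var; set m := Ex mu g.
transitivity (\sum_x (mu x * g x ^+ 2 - 2 * m * (mu x * g x) + m ^+ 2 * mu x)).
  by apply: eq_bigr => x _; ring.
rewrite big_split sumrB -!mulr_sumr mu1 -/(Ex mu g) -/m /Ex /=; ring.
Qed.

Lemma dirichlet_formZ P mu g (c : R) :
  dirichlet_form P mu (fun x => c * g x) (fun x => c * g x)
  = c ^+ 2 * dirichlet_form P mu g g.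
Proof.
rewrite /dirichlet_form mulrCA; congr (_ * _); rewrite mulr_sumr.
apply: eq_bigr => x _; rewrite mulr_sumr; apply: eq_bigr => y _; ring.
Qed.

Lemma dirichlet_form_ge0 P mu g : is_probability mu ->
  is_transition_matrix P -> 0 <= dirichlet_form P mu g g.
Proof.
move=> [mu0 _] [P0 _]; rewrite mulr_ge0 ?invr_ge0//.
apply: sumr_ge0 => x _; apply: sumr_ge0 => y _.
by apply: mulr_ge0; [rewrite -expr2 sqr_ge0 | exact: mulr_ge0].
Qed.

(** Both sides are quadratic in [g], so a function of positive variance can be rescaled to variance
    1, where it competes in the infimum. Zero variance is treated apart. *)
Lemma poincare P mu g : is_probability mu -> is_transition_matrix P ->
  spectral_gap mu P * Var mu g <= dirichlet_form P mu g g.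
Proof.
move=> hmu hP.
have V0 : 0 <= Var mu g.
  by apply: sumr_ge0 => x _; rewrite mulr_ge0 ?sqr_ge0//; case: hmu.
have [->|VN0] := eqVneq (Var mu g) 0.
  by rewrite mulr0 dirichlet_form_ge0.
have {VN0}V0 : 0 < Var mu g by rewrite lt_def VN0.
pose c := (Num.sqrt (Var mu g))^-1.
have c2 : c ^+ 2 = (Var mu g)^-1 by rewrite exprVn sqr_sqrtr// ltW.
rewrite -ler_pdivlMr// mulrC -c2 -dirichlet_formZ.
apply: ge_inf.
  (* The infimum is a lower bound only once the set is known to be bounded below. *)
  by exists 0 => _ [h _ <-]; exact: dirichlet_form_ge0.
by exists (fun x => c * g x) => //=; rewrite VarZ c2 mulVf// gt_eqF.
Qed.

(** * Dirichlet form of an exponential and the halving inequality *)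

Lemma asym_lipschitz_sqr P f x : is_transition_matrix P ->
  \sum_y P x y * `|f x - f y| ^+ 2 * \1_(`]0, +oo[ : set R) (f x - f y)
    <= asym_lipschitz P f ^+ 2.
Proof.
move=> [P0 _]; set S := (X in X <= _).
have S0 : 0 <= S.
  apply: sumr_ge0 => y _; rewrite indicE.
  by do 2?apply: mulr_ge0 => //; rewrite sqr_ge0.
have SL : Num.sqrt S <= asym_lipschitz P f.
  exact: (le_bigmax 0 (fun x => Num.sqrt (\sum_y P x y * `|f x - f y| ^+ 2
                                * \1_(`]0, +oo[ : set R) (f x - f y))) x).
rewrite -(sqr_sqrtr S0) lerXn2r ?nnegrE ?sqrtr_ge0//.
exact: le_trans (sqrtr_ge0 S) SL.
Qed.

(** For [b < a] only the first indicator survives, and [e^(sa) - e^(sb) = e^(sa) (1 - e^(-s(a-b)))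
    <= s (a - b) e^(sa)]. Weighting by the larger exponential is what lets a one-sided Lipschitz
    constant suffice; the symmetric form covers both orders. *)
Lemma expR_diff_sqr_le (s a b : R) : 0 <= s ->
  (expR (s * a) - expR (s * b)) ^+ 2
    <= s ^+ 2 * (expR (2 * s * a) * `|a - b| ^+ 2 * \1_(`]0, +oo[ : set R) (a - b)
                 + expR (2 * s * b) * `|b - a| ^+ 2 * \1_(`]0, +oo[ : set R) (b - a)).
Proof.
move=> s0; wlog ba : a b / b <= a.
  move=> W; case: (leP b a) => [|/ltW] ba; first exact: W.
  by rewrite -sqrrN opprB; apply: (le_trans (W b a ba)); rewrite addrC.
have [->|ab] := eqVneq a b; first by rewrite !subrr normr0 !expr0n /= !(mulr0,mul0r,addr0).
have {ab}ba : b < a by rewrite lt_def ab.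
have -> : \1_(`]0, +oo[ : set R) (a - b) = 1 :> R.
  by rewrite indicE mem_set//= in_itv /= andbT subr_gt0.
have -> : \1_(`]0, +oo[ : set R) (b - a) = 0 :> R.
  by rewrite indicE memNset//= in_itv /= andbT subr_gt0 ltNge ltW.
rewrite mulr0 addr0 mulr1 real_normK ?num_real//.
have -> : expR (2 * s * a) = expR (s * a) ^+ 2.
  by rewrite -expRM_natl mulrA.
rewrite -!exprMn lerXn2r ?nnegrE//.
- by rewrite subr_ge0 ler_expR ler_wpM2l// ltW.
- by rewrite !mulr_ge0// ?expR_ge0// subr_ge0 ltW.
have -> : expR (s * b) = expR (s * a) * expR (- (s * (a - b))).
  by rewrite -expRD; congr expR; ring.
have := expR_ge1Dx (- (s * (a - b))); have := expR_gt0 (s * a).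
by nra.
Qed.

(** Reversibility makes the two one-sided sums equal, which absorbs the factor 1/2. The weight in
    each then depends on [x] alone, so the sum over [y] is bounded by the squared Lipschitz
    constant. *)
Lemma dirichlet_form_expR_le P mu f (s : R) : is_probability mu ->
  is_transition_matrix P -> reversible mu P -> 0 <= s ->
  dirichlet_form P mu (fun x => expR (s * f x)) (fun x => expR (s * f x))
    <= s ^+ 2 * asym_lipschitz P f ^+ 2 * Ex mu (fun x => expR (2 * s * f x)).
Proof.
move=> [mu0 _] hP hrev s0.
pose K x y : R := expR (2 * s * f x) * `|f x - f y| ^+ 2
                 * \1_(`]0, +oo[ : set R) (f x - f y).
pose A : R := \sum_x \sum_y K x y * (mu x * P x y).
have sym : \sum_x \sum_y K y x * (mu x * P x y) = A.
  rewrite exchange_big; apply: eq_bigr => x _; apply: eq_bigr => y _.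
  by rewrite hrev.
apply: (@le_trans _ _ (s ^+ 2 * A)).
  have -> : s ^+ 2 * A = 2^-1 * (s ^+ 2 * (A + A)) by field.
  rewrite ler_pM2l ?invr_gt0// -{2}sym /A -big_split mulr_sumr /=.
  apply: ler_sum => x _; rewrite -big_split mulr_sumr /=.
  apply: ler_sum => y _; rewrite -mulrDl [leRHS]mulrA -expr2.
  rewrite ler_wpM2r ?mulr_ge0//; first by case: hP.
  exact: expR_diff_sqr_le.
rewrite -mulrA ler_wpM2l ?sqr_ge0// /Ex mulr_sumr; apply: ler_sum => x _.
have -> : \sum_y K x y * (mu x * P x y) = (mu x * expR (2 * s * f x)) *
   \sum_y P x y * `|f x - f y| ^+ 2 * \1_(`]0, +oo[ : set R) (f x - f y).
  by rewrite mulr_sumr; apply: eq_bigr => y _; rewrite /K; ring.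
rewrite mulrC ler_wpM2r ?mulr_ge0 ?expR_ge0//; exact: asym_lipschitz_sqr.
Qed.

Lemma Ex_expR_gt0 mu f (s : R) : is_probability mu ->
  0 < Ex mu (fun x => expR (s * f x)).
Proof.
move=> [mu0 mu1].
have h0 x : 0 <= mu x * expR (s * f x) by rewrite mulr_ge0 ?expR_ge0.
rewrite lt_def sumr_ge0 ?andbT//; apply/eqP => /psumr_eq0P h.
have : \sum_x mu x = 0.
  apply: big1 => x _; have /eqP := h (fun x _ => h0 x) x isT.
  by rewrite mulf_eq0 (gt_eqF (expR_gt0 _)) orbF => /eqP.
by move/eqP; rewrite mu1 oner_eq0.
Qed.

(** The free parameter [u] allows the squared ratio to be replaced by the larger quantity occurring
    in [Theta_term]. *)
Lemma ln_mgf_halve P mu f (lambda u : R) : is_probability mu ->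
  is_transition_matrix P -> reversible mu P ->
  0 < spectral_gap mu P -> 0 < asym_lipschitz P f ->
  0 <= lambda -> (lambda / Xi_plus P mu f) ^+ 2 <= u -> u < 1 ->
  ln (Ex mu (fun x => expR (lambda * f x)))
    <= 2 * ln (Ex mu (fun x => expR (lambda / 2 * f x))) + ln (1 / (1 - u)).
Proof.
move=> hmu hP hrev hgap hlip l0 hu u1.
set M := Ex mu (fun x => expR (lambda * f x)).
set N := Ex mu (fun x => expR (lambda / 2 * f x)).
have M0 : 0 < M by exact: Ex_expR_gt0.
have N0 : 0 < N by exact: Ex_expR_gt0.
have l2 : 0 <= lambda / 2 by rewrite divr_ge0.
have := @poincare P mu (fun x => expR (lambda / 2 * f x)) hmu hP.
move=> /le_trans/(_ (dirichlet_form_expR_le _ _ f _ hmu hP hrev l2)).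
have eM : Ex mu (fun x => expR (2 * (lambda / 2) * f x)) = M.
  by apply: eq_bigr => x _; congr (_ * expR (_ * _)); field.
have eM' : Ex mu (fun x => expR (lambda / 2 * f x) ^+ 2) = M.
  rewrite -eM; apply: eq_bigr => x _; congr (_ * _).
  by rewrite -expRM_natl mulrA.
rewrite VarE// eM eM' -/N => h.
(* Dividing by the gap: [(lambda/2)^2 L^2 = gap (lambda/Xi)^2], where [L] is the Lipschitz constant
   and [Xi = 2 sqrt(gap) / L]. *)
have {h} : M - N ^+ 2 <= (lambda / Xi_plus P mu f) ^+ 2 * M.
  rewrite -(ler_pM2l hgap); apply: (le_trans h); rewrite le_eqVlt; apply/orP; left; apply/eqP.
  have s2 : Num.sqrt (spectral_gap mu P) ^+ 2 = spectral_gap mu P.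
    by rewrite sqr_sqrtr// ltW.
  rewrite -s2 /Xi_plus; field.
  by rewrite !gt_eqF ?sqrtr_gt0.
move=> h.
have {}h : M <= N ^+ 2 * (1 / (1 - u)).
  rewrite mulrA mulr1 ler_pdivlMr ?subr_gt0//.
  have : (lambda / Xi_plus P mu f) ^+ 2 * M <= u * M by rewrite ler_pM2r.
  by lra.
rewrite mulr_natl -lnXn// -lnM ?posrE ?exprn_gt0 ?divr_gt0 ?subr_gt0//.
by rewrite ler_ln ?posrE// (lt_le_trans M0).
Qed.

(** * The remainder of the iteration, and the Chernoff bound *)

Lemma Ex_mulr_expR_cvg mu f (s : R) :
  Ex mu (fun x => s * f x * expR (s / 2 ^+ n * f x)) @[n --> \oo]
    --> s * Ex mu f.
Proof.
rewrite -ExZ; apply: cvg_big => [|x _]; first exact: add_continuous.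
have h0 : (2 ^+ n)^-1 @[n --> \oo] --> (0 : R).
  under eq_cvg do rewrite -exprVn.
  by apply: cvg_expr; rewrite ger0_norm ?invf_lt1 ?ltr1n.
have h1 : s / 2 ^+ n * f x @[n --> \oo] --> (0 : R).
  by rewrite -[X in _ --> X](mul0r (f x)) -[X in X * _](mulr0 s); apply: cvgMl;
     exact: cvgMr.
apply: cvgMr; rewrite -[X in _ --> X]mulr1; apply: cvgMr.
rewrite -[X in _ --> X]expR0; apply: continuous_cvg => //.
exact: continuous_expR.
Qed.

(** Uses [ln M <= M - 1] and then [e^v - 1 <= v e^v] pointwise. The resulting majorant has an
    evident limit, so the logarithm need not be differentiated at 0. *)
Lemma ln_mgf_le mu f (s : R) (n : nat) : is_probability mu ->
  2 ^+ n * ln (Ex mu (fun x => expR (s / 2 ^+ n * f x)))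
    <= Ex mu (fun x => s * f x * expR (s / 2 ^+ n * f x)).
Proof.
move=> hmu; set M := Ex mu _.
have M0 : 0 < M by exact: Ex_expR_gt0.
have p0 : (0 : R) < 2 ^+ n by rewrite exprn_gt0.
have lnM : ln M <= M - 1.
  by rewrite -[in leLHS](subrK 1 M) addrC le_ln1Dx//; lra.
apply: (@le_trans _ _ (2 ^+ n * (M - 1))); first by rewrite ler_pM2l.
case: hmu => mu0 mu1.
(* Writing 1 as the total mass turns [M - 1] into a sum comparable term by term. *)
rewrite -[X in _ * (_ - X)]mu1 /M /Ex -sumrB mulr_sumr; apply: ler_sum => x _.
set v := s / 2 ^+ n * f x.
have -> : s * f x = 2 ^+ n * v by rewrite /v; field; rewrite gt_eqF.
(* [e^v - 1 <= v e^v], i.e. [1 - v <= e^-v] *)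
have h : expR v - 1 <= v * expR v.
  have := expR_ge1Dx (- v); rewrite expRN -(ler_pM2r (expR_gt0 v)).
  by rewrite mulVf ?gt_eqF ?expR_gt0//; lra.
have -> : 2 ^+ n * (mu x * expR v - mu x) = 2 ^+ n * (mu x * (expR v - 1)) by ring.
by rewrite [leRHS]mulrCA -mulrA ler_pM2l// [leRHS]mulrCA !ler_wpM2l.
Qed.

(** Chernoff bound: the expectation is restricted to the event, where [f x >= a + Ex mu f]. *)
Lemma fluctuation_plus_mgf_le mu f (lambda a : R) : is_probability mu ->
  0 <= lambda ->
  fluctuation_plus mu f a * expR (lambda * (a + Ex mu f))
    <= Ex mu (fun x => expR (lambda * f x)).
Proof.
move=> [mu0 _] l0; rewrite /fluctuation_plus mulr_suml.
rewrite /Ex [leRHS](bigID (fun x => a <= f x - Ex mu f)) /= ler_wpDr//.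
  by apply: sumr_ge0 => x _; rewrite mulr_ge0 ?expR_ge0.
apply: ler_sum => x ax; rewrite ler_wpM2l// ler_expR ler_wpM2l//.
by rewrite -lerBrDr.
Qed.

End Mgf.

(** * Iteration, passage to the limit and conclusion *)

(** Step [n] applies the halving inequality at [lambda / 2^n] with [u = t 4^-n], weighted by [2^n];
    its logarithmic term is then exactly [Theta_term t n]. *)
Lemma ln_mgf_le_iter {R : realType} {X : finType} (P : X -> X -> R)
    (mu f : X -> R) (lambda : R) (n : nat) :
  is_probability mu -> is_transition_matrix P -> reversible mu P ->
  0 < spectral_gap mu P -> 0 < asym_lipschitz P f ->
  0 <= lambda -> lambda < Xi_plus P mu f ->
  ln (Ex mu (fun x => expR (lambda * f x)))
    <= 2 ^+ n * ln (Ex mu (fun x => expR (lambda / 2 ^+ n * f x)))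
       + series (Theta_term (lambda / Xi_plus P mu f)) n.
Proof.
move=> hmu hP hrev hgap hlip l0 lXi.
have Xi0 : 0 < Xi_plus P mu f by exact: le_lt_trans lXi.
elim: n => [|n IH].
  by rewrite expr0 divr1 mul1r seriesEnat /= big_geq// addr0.
apply: (le_trans IH); rewrite seriesSr [X in _ <= _ + X]addrC addrA lerD2r.
set t := lambda / Xi_plus P mu f.
have t0 : 0 <= t by rewrite divr_ge0// ltW.
have t1 : t < 1 by rewrite ltr_pdivrMr// mul1r.
have p0 : (0 : R) < 2 ^+ n by rewrite exprn_gt0.
have q1 : (2 : R) ^- (2 * n) <= 1.
  by rewrite invf_le1 ?exprn_gt0// exprn_ege1// ler1n.
have q0 : (0 : R) < 2 ^- (2 * n) by rewrite invr_gt0 exprn_gt0.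
have -> : lambda / 2 ^+ n.+1 = lambda / 2 ^+ n / 2.
  by rewrite exprSr invfM mulrA.
rewrite /Theta_term exprSr -mulrA -mulrDr ler_pM2l//.
apply: ln_mgf_halve hmu hP hrev hgap hlip _ _ _.
- by rewrite divr_ge0// ltW.
(* Here [(t 2^-n)^2 = t^2 4^-n <= t 4^-n]. *)
- rewrite mulrAC -/t exprMn exprVn -exprM mulnC ler_pM2r// expr2.
  by rewrite ler_piMr// ltW.
- by rewrite (le_lt_trans _ t1)// ler_piMr.
Qed.

Lemma ln_mgf_le_Theta {R : realType} {X : finType} (P : X -> X -> R)
    (mu f : X -> R) (lambda : R) :
  is_probability mu -> is_transition_matrix P -> reversible mu P ->
  0 < spectral_gap mu P -> 0 < asym_lipschitz P f ->
  0 <= lambda -> lambda < Xi_plus P mu f ->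
  ln (Ex mu (fun x => expR (lambda * f x)))
    <= lambda * Ex mu f + Theta (lambda / Xi_plus P mu f).
Proof.
move=> hmu hP hrev hgap hlip l0 lXi.
have Xi0 : 0 < Xi_plus P mu f by exact: le_lt_trans lXi.
have t01 : 0 <= lambda / Xi_plus P mu f < 1.
  by rewrite divr_ge0 ?(ltW Xi0)//= ltr_pdivrMr// mul1r.
rewrite -lerBlDr.
have cvgE := @Ex_mulr_expR_cvg R X mu f lambda.
(* With [lambda * Ex mu f] seen as the limit of the majorants, it is enough to prove the inequality
   at each [n]. *)
rewrite -(cvg_lim _ cvgE)//.
apply: limr_ge; first by apply/cvg_ex; exists (lambda * Ex mu f).
near=> n; rewrite lerBlDr.
apply: (le_trans (ln_mgf_le_iter P mu f lambda n hmu hP hrev hgap hlip l0 lXi)).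
by apply: lerD; [exact: ln_mgf_le | exact: series_Theta_le].
Unshelve. all: by end_near. Qed.

Theorem theorem1p4 (R : realType) (X : finType) (hX : (2 <= #|X|)%N)
    (mu : X -> R) (hmu : is_probability mu) (hmu_pos : non_degenerate mu)
    (P : X -> X -> R) (hP : is_transition_matrix P) (hrev : reversible mu P)
    (f : X -> R)
    (hgap : 0 < spectral_gap mu P) (hlip : 0 < asym_lipschitz P f) :
  (forall lambda : R, 0 <= lambda -> lambda < Xi_plus P mu f ->
     ln (Ex mu (fun x => expR (lambda * f x)))
       <= lambda * Ex mu f + Theta (lambda / Xi_plus P mu f))
  /\
  (forall a : R, 0 <= a ->
     exists2 m : R,
       is_maximum
         [set lambda * a - Theta (lambda / Xi_plus P mu f)
            | lambda in [set lambda : R | 0 <= lambda < Xi_plus P mu f]] m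
       & (m%:E <= - lne (fluctuation_plus mu f a)%:E)%E).
Proof.
have mgf_le lambda := @ln_mgf_le_Theta R X P mu f lambda hmu hP hrev hgap hlip.
split=> [lambda l0 lXi|a a0]; first exact: mgf_le.
have Xi0 : 0 < Xi_plus P mu f.
  by rewrite divr_gt0// mulr_gt0// sqrtr_gt0.
have aXi0 : 0 <= Xi_plus P mu f * a by rewrite mulr_ge0// ltW.
(* Substituting [t = lambda / Xi] and [b = Xi * a] turns [lambda * a] into [t * b]. *)
have [t /andP[t0 t1] tmax] := @Theta_conjugate_attained R _ aXi0.
have tXi : 0 <= t * Xi_plus P mu f < Xi_plus P mu f.
  by rewrite mulr_ge0 ?(ltW Xi0)//= -[ltRHS]mul1r ltr_pM2r.
exists (t * Xi_plus P mu f * a - Theta (t * Xi_plus P mu f / Xi_plus P mu f)).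
  split; first by exists (t * Xi_plus P mu f).
  move=> _ [lambda /= /andP[l0 lXi] <-].
  rewrite mulfK ?gt_eqF// -mulrA.
  have := tmax (lambda / Xi_plus P mu f); rewrite mulrA divfK ?gt_eqF//; apply.
  by rewrite divr_ge0 ?(ltW Xi0)//= ltr_pdivrMr// mul1r.
(* The tail bound holds for every admissible [lambda], so the maximizer is generalized. *)
move: (t * Xi_plus P mu f) tXi => lambda /andP[l0 lXi].
set F := fluctuation_plus mu f a.
(* An event of mass 0 gives [- lne 0 = +oo], in accordance with the convention. *)
case: (leP F 0) => F0; first by rewrite le0_lneNy ?lee_fin//= leey.
rewrite lne_EFin// -EFinN lee_fin lerNr.
have := @fluctuation_plus_mgf_le R X mu f lambda a hmu l0.
rewrite -ler_ln ?posrE ?mulr_gt0 ?expR_gt0 ?Ex_expR_gt0// -/F.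
rewrite lnM ?posrE ?expR_gt0// expRK.
by have := mgf_le lambda l0 lXi; lra.
Qed.
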